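(* Let $K\in\mathbb{R}^{N\times N}$, $N=n^2$, let $1\le k<N$ be a truncation index, and consider the two factorizations of $K$ $$K = U_k\Sigma_k V_k^T + U_0\Sigma_0V_0^T$$ (the partitioned singular value decomposition of $K$, with true singular values $\sigma_1\ge\cdots\ge\sigma_N\ge 0$) and $$K=\widehat U\left(\begin{bmatrix}\widehat\Sigma_k&0\\0&\widehat\Sigma_0\end{bmatrix}+\begin{bmatrix}0&\widehat W_{12}\\ \widehat W_{21}&W_{22}\end{bmatrix}\right)\widehat V^T,\qquad \widehat U=[\,\widehat U_k\ \ \widehat U_0\,],\quad \widehat V=[\,\widehat V_k\ \ \widehat V_0\,]$$ (the factorization of $K$ constructed from its Kronecker sum decomposition as described in the context, with approximate singular values $\widehat\sigma_i$). Then $$\|U_k^T\widehat U_0\|\le\frac{\sigma_k\|\widehat W_{21}\|+\|\widehat W_{12}\|\,\|\widehat\Sigma_0+W_{22}\|}{\sigma_k^2-\|\widehat\Sigma_0+W_{22}\|^2}$$ and $$\|V_k^T\widehat V_0\|\le\frac{\sigma_k\|\widehat W_{12}\|+\|\widehat W_{21}\|\,\|\widehat\Sigma_0+W_{22}\|}{\sigma_k^2-\|\widehat\Sigma_0+W_{22}\|^2}.$$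
   Context: All norms are spectral (2-)norms. $\otimes$ is the Kronecker product, $(A\otimes B)=[a_{ij}B]$ in block form. True SVD: $K=U\Sigma V^T$ with $U,V$ orthogonal and $\Sigma=\mathrm{diag}(\sigma_1,\dots,\sigma_N)$, $\sigma_1\ge\cdots\ge\sigma_N\ge0$. $U_k,V_k$ are the first $k$ columns of $U,V$; $U_0,V_0$ are the remaining $N-k$ columns; $\Sigma_k=\mathrm{diag}(\sigma_1,\dots,\sigma_k)$ and $\Sigma_0=\mathrm{diag}(\sigma_{k+1},\dots,\sigma_N)$. Kronecker sum decomposition: $K=\sum_{i=1}^R A_i\otimes B_i$ with $A_i,B_i\in\mathbb{R}^{n\times n}$, where $R$ is the Kronecker rank of $K$ (the number of terms needed for such a decomposition to be exact). It is obtained as follows. Let $\widetilde K$ be the $n^2\times n^2$ rearrangement of $K$, the linear rearrangement of entries such that $\widetilde K=\mathrm{vec}(A)\mathrm{vec}(B)^T$ whenever $K=A\otimes B$ with $A,B\in\mathbb{R}^{n\times n}$ ($\mathrm{vec}$ stacks columns). If $\widetilde K=\sum_{i=1}^R s_i u_iv_i^T$ is an SVD with $s_1\ge\dots\ge s_R>0$, then $\mathrm{vec}(A_i)=\sqrt{s_i}\,u_i$ and $\mathrm{vec}(B_i)=\sqrt{s_i}\,v_i$. Construction of the second factorization: Let $A_1=U_A\Sigma_AV_A^T$ and $B_1=U_B\Sigma_BV_B^T$ be SVDs. Put $U_1=U_A\otimes U_B$, $\Sigma_1=\Sigma_A\otimes\Sigma_B$, $V_1=V_A\otimes V_B$, and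 $W=U_1^T\left(\sum_{i=2}^R A_i\otimes B_i\right)V_1$, so that $K=U_1(\Sigma_1+W)V_1^T$. Let $P$ be a permutation matrix such that the diagonal of $P^T\Sigma_1P=\mathrm{diag}(\sigma_{1,1},\dots,\sigma_{1,N})$ is in descending order. Put $\Sigma_{1,k}=\mathrm{diag}(\sigma_{1,1},\dots,\sigma_{1,k})$ and $\widehat\Sigma_0=\mathrm{diag}(\sigma_{1,k+1},\dots,\sigma_{1,N})$, and partition conformally $$P^TWP=\begin{bmatrix}W_{11}&W_{12}\\ W_{21}&W_{22}\end{bmatrix},\qquad W_{11}\in\mathbb{R}^{k\times k}.$$ Let $\Sigma_{1,k}+W_{11}=\widehat U_t\widehat\Sigma_t\widehat V_t^T$ be an SVD of this $k\times k$ matrix, with $\widehat\Sigma_k:=\widehat\Sigma_t=\mathrm{diag}(\widehat\sigma_1,\dots,\widehat\sigma_k)$, $\widehat\sigma_1\ge\dots\ge\widehat\sigma_k\ge0$ (the approximate singular values). Define $\widehat W_{12}=\widehat U_t^TW_{12}$, $\widehat W_{21}=W_{21}\widehat V_t$, $$\widehat U=U_1P\begin{bmatrix}\widehat U_t&0\\0&I\end{bmatrix},\qquad \widehat V=V_1P\begin{bmatrix}\widehat V_t&0\\0&I\end{bmatrix}.$$ $\widehat U_k,\widehat V_k$ are the first $k$ columns of $\widehat U,\widehat V$, and $\widehat U_0,\widehat V_0$ the remaining $N-k$ columns.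
   Formalization: The formal theorem adds the assumption that the norm of Σ̂₀+W₂₂ is strictly less than σ_k, so the denominators are positive; without it the quotients are undefined or the bounds fail, e.g. for K = diag(1,0,0,0.9), k = 3. *)

(* Defs.v *)
From HB Require Import structures.
From mathcomp Require Import all_boot all_order all_algebra.
From mathcomp Require Import classical_sets reals.
From mathcomp Require Export mxtens.

Set Implicit Arguments.
Unset Strict Implicit.
Unset Printing Implicit Defensive.

Import Order.TTheory GRing.Theory Num.Theory.

Local Open Scope classical_set_scope.
Local Open Scope ring_scope.

Section SpectralNorm.
Variable R : realType.

Definition norm2 (p : nat) (x : 'cV[R]_p) : R :=
  Num.sqrt (\sum_i x i 0 ^+ 2).

(* The closed unit ball is used instead of the unit sphere so that the set is
   nonempty in dimension 0 too. *)
Definition specnorm (m p : nat) (A : 'M[R]_(m, p)) : R :=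
  sup [set norm2 (A *m x) | x in [set x : 'cV[R]_p | norm2 x <= 1]].

End SpectralNorm.

Section SVD.
Variable R : realType.

Definition orthogonal_mx (m : nat) (U : 'M[R]_m) : Prop :=
  U^T *m U = 1%:M /\ U *m U^T = 1%:M.

Definition is_svd (m : nat) (M U : 'M[R]_m) (s : 'rV[R]_m) (V : 'M[R]_m) :
    Prop :=
  [/\ orthogonal_mx U, orthogonal_mx V,
      forall i, 0 <= s 0 i,
      forall i j : 'I_m, (i <= j)%N -> s 0 j <= s 0 i &
      M = U *m diag_mx s *m V^T].

Definition is_reduced_svd (m p r : nat) (M : 'M[R]_(m, p)) (s : 'I_r -> R)
    (u : 'I_r -> 'cV[R]_m) (v : 'I_r -> 'cV[R]_p) : Prop :=
  [/\ forall i j, (u i)^T *m u j = (i == j)%:R%:M,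
      forall i j, (v i)^T *m v j = (i == j)%:R%:M,
      forall i, 0 < s i,
      forall i j : 'I_r, (i <= j)%N -> s j <= s i &
      M = \sum_i s i *: (u i *m (v i)^T)].

End SVD.

Section Kronecker.
Variable R : realType.
Variable n : nat.
Implicit Types (A B : 'M[R]_n) (K : 'M[R]_(n * n)).

(* [mxtens_unindex] sends a * n + b to (a, b). Stacking columns puts A i j at
   position j * n + i, so the row index of A is the second component. *)
Definition vec A : 'cV[R]_(n * n) :=
  \col_a A (mxtens_unindex a).2 (mxtens_unindex a).1.

(* Entry (i1 * n + i2, j1 * n + j2) of K moves to (j1 * n + i1, j2 * n + i2);
   [rearrange_tens] is the property that characterizes this linear map. *)
Definition rearrange K : 'M[R]_(n * n) :=
  \matrix_(a, b)
    K (mxtens_index ((mxtens_unindex a).2, (mxtens_unindex b).2))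
      (mxtens_index ((mxtens_unindex a).1, (mxtens_unindex b).1)).

Lemma rearrange_tens A B : rearrange (A *t B) = vec A *m (vec B)^T.
Proof. by apply/matrixP=> a b; rewrite !mxE !mxtens_indexK big_ord1 !mxE. Qed.

Lemma rearrange_sum (I : finType) (F : I -> 'M[R]_(n * n)) :
  rearrange (\sum_i F i) = \sum_i rearrange (F i).
Proof.
by apply/matrixP=> a b; rewrite mxE !summxE; apply: eq_bigr=> i _; rewrite mxE.
Qed.

Lemma rearrange_inj : injective rearrange.
Proof.
move=> K L /matrixP eKL; apply/matrixP=> i j.
case: (mxtens_indexP i)=> i1 i2; case: (mxtens_indexP j)=> j1 j2.
have := eKL (mxtens_index (j1, i1)) (mxtens_index (j2, i2)).
by rewrite !mxE !mxtens_indexK.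
Qed.

Definition is_kron_sum (r : nat) K (A B : 'I_r -> 'M[R]_n) : Prop :=
  K = \sum_i A i *t B i.

Definition is_kron_rank K (r : nat) : Prop :=
  (exists A B : 'I_r -> 'M[R]_n, is_kron_sum K A B) /\
  (forall (r' : nat) (A B : 'I_r' -> 'M[R]_n),
     is_kron_sum K A B -> (r <= r')%N).

Definition is_kron_svd (r : nat) K (s : 'I_r -> R)
    (u v : 'I_r -> 'cV[R]_(n * n)) (A B : 'I_r -> 'M[R]_n) : Prop :=
  [/\ is_reduced_svd (rearrange K) s u v,
      forall i, vec (A i) = Num.sqrt (s i) *: u i &
      forall i, vec (B i) = Num.sqrt (s i) *: v i].

Lemma kron_svd_sum r K (s : 'I_r -> R) u v
    (A B : 'I_r -> 'M[R]_n) :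
  is_kron_svd K s u v A B -> is_kron_sum K A B.
Proof.
move=> [[_ _ s_gt0 _ eK] eA eB]; apply: rearrange_inj.
rewrite rearrange_sum eK; apply: eq_bigr=> i _.
rewrite rearrange_tens eA eB linearZ /= -scalemxAr -scalemxAl scalerA.
by rewrite -expr2 sqr_sqrtr // ltW.
Qed.

Lemma kron_svd_rank r K (s : 'I_r -> R) u v
    (A B : 'I_r -> 'M[R]_n) :
  is_kron_svd K s u v A B -> is_kron_rank K r.
Proof.
move=> Ksvd; split; first by exists A, B; apply: kron_svd_sum Ksvd.
case: Ksvd=> [[uu vv s_gt0 _ eK] _ _] r' A' B' eK'.
have rank_le : (\rank (rearrange K) <= r')%N.
  rewrite eK' rearrange_sum.
  suff le_sum (I : Type) (l : seq I) (F : I -> 'M[R]_(n * n)) :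
      (forall i, \rank (F i) <= 1)%N ->
      (\rank (\sum_(i <- l) F i)%R <= size l)%N.
    rewrite -[leqRHS](size_enum_ord r') enumT; apply: le_sum=> i.
    by rewrite rearrange_tens (leq_trans (mxrankM_maxl _ _)) ?rank_leq_col.
  move=> F1; elim: l=> [|i l IHl]; first by rewrite big_nil mxrank0.
  by rewrite big_cons (leq_trans (mxrank_add _ _)) // (leq_add (F1 i) IHl).
apply: leq_trans rank_le.
pose Um := \matrix_(a < n * n, i < r) u i a 0.
pose Vm := \matrix_(a < n * n, i < r) v i a 0.
have dotE (w : 'I_r -> 'cV[R]_(n * n)) :
    (forall i j, (w i)^T *m w j = (i == j)%:R%:M) ->
    forall i j, \sum_a w i a 0 * w j a 0 = (i == j)%:R.
  move=> ww i j; have /matrixP/(_ 0 0) := ww i j.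
  by rewrite !mxE mulr1n => <-; apply: eq_bigr=> a _; rewrite mxE.
have UU : Um^T *m Um = 1%:M.
  apply/matrixP=> i j; rewrite !mxE -(dotE _ uu).
  by apply: eq_bigr=> a _; rewrite !mxE.
have VV : Vm^T *m Vm = 1%:M.
  apply/matrixP=> i j; rewrite !mxE -(dotE _ vv).
  by apply: eq_bigr=> a _; rewrite !mxE.
have eKm : rearrange K = Um *m diag_mx (\row_i s i) *m Vm^T.
  rewrite eK; apply/matrixP=> a b; rewrite summxE mxE.
  apply: eq_bigr=> i _; rewrite mul_mx_diag !mxE big_ord1 !mxE.
  by rewrite mulrA [s i * _]mulrC.
have eD : Um^T *m rearrange K *m Vm = diag_mx (\row_i s i).
  by rewrite eKm !mulmxA UU mul1mx -mulmxA VV mulmx1.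
have : diag_mx (\row_i s i) \in unitmx.
  rewrite unitmxE det_diag unitfE; apply/prodf_neq0=> i _.
  by rewrite mxE gt_eqF.
rewrite -row_free_unit -eD => /eqP <-.
by rewrite (leq_trans (mxrankM_maxl _ _)) // mxrankM_maxr.
Qed.

End Kronecker.

Section Blocks.
Variable R : realType.
Variables N k : nat.
Hypothesis le_kN : (k <= N)%N.

Definition split_cols (m : nat) (A : 'M[R]_(m, N)) : 'M[R]_(m, k + (N - k)) :=
  castmx (erefl m, esym (subnKC le_kN)) A.

Definition first_cols (m : nat) (A : 'M[R]_(m, N)) : 'M[R]_(m, k) :=
  lsubmx (split_cols A).

Definition last_cols (m : nat) (A : 'M[R]_(m, N)) : 'M[R]_(m, N - k) :=
  rsubmx (split_cols A).

Definition to_blocks (A : 'M[R]_N) : 'M[R]_(k + (N - k)) :=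
  castmx (esym (subnKC le_kN), esym (subnKC le_kN)) A.

Definition of_blocks (A : 'M[R]_(k + (N - k))) : 'M[R]_N :=
  castmx (subnKC le_kN, subnKC le_kN) A.

End Blocks.

(* The k-th diagonal entry, counting from 1. *)
Definition kth (R : realType) (N k : nat) (lt_kN : (k < N)%N) (s : 'rV[R]_N) :
    R :=
  s 0 (Ordinal (leq_ltn_trans (leq_pred k) lt_kN)).

(* Main.v *)
Require Import Defs.
From HB Require Import structures.
From mathcomp Require Import all_boot all_order all_algebra.
From mathcomp Require Import fingroup perm ring lra.
From mathcomp Require Import classical_sets reals.

Set Implicit Arguments.
Unset Strict Implicit.
Unset Printing Implicit Defensive.

Import Order.TTheory GRing.Theory Num.Theory.
Local Open Scope ring_scope.

(** The bounds are a perturbation theorem of Wedin type, and only one feature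
    of the Kronecker construction matters: in the orthogonal bases [hU], [hV]
    the matrix [K] has off-diagonal blocks [hW12], [hW21] and trailing block
    [M = hSigma0 + W22].  Reading off the trailing block column and row gives
      K hV0 = hUk hW12 + hU0 M     and     K^T hU0 = hVk hW21^T + hV0 M^T.
    Multiplying these by [Uk^T] and [Vk^T], and using [Uk^T K = Sigmak Vk^T]
    and [Vk^T K^T = Sigmak Uk^T], yields for [X = Uk^T hU0], [Y = Vk^T hV0]
    the pair of equations
      Sigmak Y = (Uk^T hUk) hW12 + X M,
      Sigmak X = (Vk^T hVk) hW21^T + Y M^T.
    Products such as [Uk^T hUk] of matrices with orthonormal columns have norm
    at most 1, and [Sigmak] expands norms by at least [sigmak], so
      sigmak |X| <= |hW21| + |M| |Y|   and   sigmak |Y| <= |hW12| + |M| |X|.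
    Eliminating [|Y|] gives the bound on [|X|], the gap [|M| < sigmak] making
    the denominator positive; this is [singular_subspace_bound].  The bound on
    [|Y|] is the same statement for [K^T], which exchanges the left and the
    right bases and [hW12] with [hW21^T].

    What remains is to identify the blocks of [hU^T K hV].  The mixed product
    rule for Kronecker products gives [U1^T K V1 = Sigma1 + W]; conjugation by
    [P] keeps [Sigma1] diagonal, and the change of basis by [hUt], [hVt] acts
    on the leading index block only, hence leaves [M] alone. *)

(** * Euclidean and spectral norms *)

Section SpectralNormTheory.
Variable R : realType.

Lemma norm2_ge0 (p : nat) (x : 'cV[R]_p) : 0 <= norm2 x.
Proof. exact: sqrtr_ge0. Qed.

Lemma sqr_norm2_sum (p : nat) (x : 'cV[R]_p) :
  norm2 x ^+ 2 = \sum_i x i 0 ^+ 2.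
Proof. by rewrite sqr_sqrtr // sumr_ge0 // => i _; exact: sqr_ge0. Qed.

Lemma sqr_norm2 (p : nat) (x : 'cV[R]_p) : norm2 x ^+ 2 = (x^T *m x) 0 0.
Proof. by rewrite sqr_norm2_sum mxE; apply: eq_bigr => i _; rewrite mxE. Qed.

Lemma norm2_coord (p : nat) (x : 'cV[R]_p) i : `|x i 0| <= norm2 x.
Proof.
rewrite -(ler_pXn2r (n := 2)) ?nnegrE ?norm2_ge0 //.
rewrite real_normK ?num_real // sqr_norm2_sum (bigD1 i) //= lerDl.
by rewrite sumr_ge0 // => j _; exact: sqr_ge0.
Qed.

Lemma norm2_eq0 (p : nat) (x : 'cV[R]_p) : norm2 x = 0 -> x = 0.
Proof.
move=> x0; apply/matrixP => i j; rewrite [j]ord1 mxE.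
by apply/eqP; rewrite -normr_le0 -x0 norm2_coord.
Qed.

Lemma norm2_0 (p : nat) : norm2 (0 : 'cV[R]_p) = 0.
Proof. by apply/eqP; rewrite -sqrf_eq0 sqr_norm2 mulmx0 mxE. Qed.

Lemma norm2Z (p : nat) (a : R) (x : 'cV[R]_p) :
  norm2 (a *: x) = `|a| * norm2 x.
Proof.
apply/eqP; rewrite -(eqrXn2 (n := 2)) ?mulr_ge0 ?norm2_ge0 //.
rewrite exprMn !sqr_norm2 real_normK ?num_real //.
by rewrite [_^T]linearZ /= -scalemxAl -scalemxAr scalerA mxE expr2.
Qed.

Lemma sqr_norm2_lincomb (p : nat) (a b : R) (x y : 'cV[R]_p) :
  norm2 (a *: x + b *: y) ^+ 2 =
  a ^+ 2 * norm2 x ^+ 2 + 2 * a * b * (x^T *m y) 0 0 + b ^+ 2 * norm2 y ^+ 2.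
Proof.
have yx : (y^T *m x) 0 0 = (x^T *m y) 0 0.
  by rewrite -[in RHS](trmxK y) -trmx_mul [RHS]mxE.
rewrite !sqr_norm2 [(_ + _)^T]linearD /= ![(_ *: _)^T]linearZ /= mulmxDl !mulmxDr.
rewrite -!scalemxAl -!scalemxAr ![(_ + _ : 'M_(_, _)) 0 0]mxE.
rewrite ![(_ *: _ : 'M_(_, _)) 0 0]mxE yx; ring.
Qed.

(** The vector [|y| x - |x| y] vanishes when [x] and [y] point the same way;
    its squared norm is [2 |x| |y|] times the defect of the inequality. *)
Lemma cauchy_schwarz (p : nat) (x y : 'cV[R]_p) :
  (x^T *m y) 0 0 <= norm2 x * norm2 y.
Proof.
have [/norm2_eq0 ->|x0] := eqVneq (norm2 x) 0.
  by rewrite norm2_0 mul0r trmx0 mul0mx mxE.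
have [/norm2_eq0 ->|y0] := eqVneq (norm2 y) 0.
  by rewrite norm2_0 mulr0 mulmx0 mxE.
have xy_gt0 : 0 < 2 * (norm2 x * norm2 y).
  by rewrite mulr_gt0 // mulr_gt0 // lt0r ?x0 ?y0 norm2_ge0.
rewrite -(ler_pM2l xy_gt0) -subr_ge0.
have := sqr_ge0 (norm2 (norm2 y *: x + - norm2 x *: y)).
rewrite sqr_norm2_lincomb; lra.
Qed.

Lemma norm2D (p : nat) (x y : 'cV[R]_p) : norm2 (x + y) <= norm2 x + norm2 y.
Proof.
rewrite -(ler_pXn2r (n := 2)) ?nnegrE ?addr_ge0 ?norm2_ge0 //.
have := sqr_norm2_lincomb 1 1 x y; rewrite !scale1r => ->.
have := cauchy_schwarz x y; lra.
Qed.

Lemma norm2_sum (p : nat) (I : Type) (l : seq I) (F : I -> 'cV[R]_p) :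
  norm2 (\sum_(i <- l) F i) <= \sum_(i <- l) norm2 (F i).
Proof.
elim/big_ind2: _ => [|x a y b xa yb|//]; first by rewrite norm2_0.
exact: le_trans (norm2D _ _) (lerD xa yb).
Qed.

(** [sup] is a meaningful value only on bounded sets, so every later use of
    [specnorm] rests on this crude bound by the column norms. *)
Lemma specnorm_has_ubound (m p : nat) (A : 'M[R]_(m, p)) :
  has_ubound [set norm2 (A *m x) | x in [set x : 'cV[R]_p | norm2 x <= 1]].
Proof.
exists (\sum_j norm2 (col j A)) => _ [x x1 <-].
have -> : A *m x = \sum_j x j 0 *: col j A.
  apply/matrixP => i j; rewrite [j]ord1 mxE summxE; apply: eq_bigr => l _.
  by rewrite !mxE mulrC.
rewrite (le_trans (norm2_sum _ _)) // ler_sum // => j _.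
by rewrite norm2Z ler_piMl ?norm2_ge0 // (le_trans (norm2_coord _ _)).
Qed.

Lemma norm2_mulmx_le (m p : nat) (A : 'M[R]_(m, p)) (x : 'cV[R]_p) :
  norm2 (A *m x) <= specnorm A * norm2 x.
Proof.
have [/norm2_eq0 ->|x0] := eqVneq (norm2 x) 0.
  by rewrite mulmx0 !norm2_0 mulr0.
have xgt0 : 0 < norm2 x by rewrite lt0r x0 norm2_ge0.
rewrite -ler_pdivrMr //; apply: (ub_le_sup (specnorm_has_ubound A)).
have nV : `|(norm2 x)^-1| = (norm2 x)^-1 by rewrite ger0_norm ?invr_ge0 ?ltW.
exists ((norm2 x)^-1 *: x); first by rewrite /= norm2Z nV mulVf.
by rewrite -scalemxAr norm2Z nV mulrC.
Qed.

Lemma specnorm_le (m p : nat) (A : 'M[R]_(m, p)) (c : R) : 0 <= c ->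
  (forall x, norm2 (A *m x) <= c * norm2 x) -> specnorm A <= c.
Proof.
move=> c0 Ac; apply: ge_sup => [|_ [x x1 <-]].
  by exists (norm2 (A *m 0)), 0; rewrite //= norm2_0.
by rewrite (le_trans (Ac x)) // ler_piMr.
Qed.

Lemma specnorm_ge0 (m p : nat) (A : 'M[R]_(m, p)) : 0 <= specnorm A.
Proof.
apply: (ub_le_sup (specnorm_has_ubound A)).
by exists 0; rewrite /= ?mulmx0 norm2_0.
Qed.

Lemma specnormD (m p : nat) (A B : 'M[R]_(m, p)) :
  specnorm (A + B) <= specnorm A + specnorm B.
Proof.
apply: specnorm_le => [|x]; first by rewrite addr_ge0 ?specnorm_ge0.
by rewrite mulmxDl (le_trans (norm2D _ _)) // mulrDl lerD ?norm2_mulmx_le.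
Qed.

Lemma specnormM (m p q : nat) (A : 'M[R]_(m, p)) (B : 'M[R]_(p, q)) :
  specnorm (A *m B) <= specnorm A * specnorm B.
Proof.
apply: specnorm_le => [|x]; first by rewrite mulr_ge0 ?specnorm_ge0.
rewrite -mulmxA (le_trans (norm2_mulmx_le _ _)) // -mulrA.
by rewrite ler_wpM2l ?specnorm_ge0 ?norm2_mulmx_le.
Qed.

(** With [z = A^T y], Cauchy-Schwarz gives
    [|z|^2 = y^T (A z) <= |y| |A| |z|], and [|z|] cancels. *)
Lemma specnorm_trmx_le (m p : nat) (A : 'M[R]_(m, p)) :
  specnorm A^T <= specnorm A.
Proof.
apply: specnorm_le => [|y]; first exact: specnorm_ge0.
have [->|z0] := eqVneq (norm2 (A^T *m y)) 0.
  by rewrite mulr_ge0 ?specnorm_ge0 ?norm2_ge0.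
have zgt0 : 0 < norm2 (A^T *m y) by rewrite lt0r z0 norm2_ge0.
rewrite -(ler_pM2r zgt0) -expr2 sqr_norm2 trmx_mul trmxK -mulmxA.
apply: le_trans (cauchy_schwarz _ _) _.
rewrite mulrC mulrAC ler_wpM2r ?norm2_ge0 //; exact: norm2_mulmx_le.
Qed.

Lemma specnorm_trmx (m p : nat) (A : 'M[R]_(m, p)) :
  specnorm A^T = specnorm A.
Proof.
by apply/eqP; rewrite eq_le specnorm_trmx_le -{1}(trmxK A) specnorm_trmx_le.
Qed.

Lemma specnorm_isometry (m p : nat) (Q : 'M[R]_(m, p)) :
  Q^T *m Q = 1%:M -> specnorm Q <= 1.
Proof.
move=> QQ; apply: specnorm_le => // x; rewrite mul1r.
rewrite -(ler_pXn2r (n := 2)) ?nnegrE ?norm2_ge0 //.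
by rewrite !sqr_norm2 trmx_mul mulmxA -(mulmxA x^T) QQ mulmx1.
Qed.

(** A diagonal matrix with entries at least [c] stretches every vector by at
    least [c], in particular those in the image of [X]. *)
Lemma specnorm_diag_mull (k l : nat) (d : 'rV[R]_k) (c : R)
    (X : 'M[R]_(k, l)) : 0 < c -> (forall i, c <= d 0 i) ->
  c * specnorm X <= specnorm (diag_mx d *m X).
Proof.
move=> c0 cd; rewrite mulrC -ler_pdivlMr //.
apply: specnorm_le => [|x]; first by rewrite divr_ge0 ?specnorm_ge0 ?ltW.
rewrite mulrAC ler_pdivlMr // (le_trans _ (norm2_mulmx_le _ _)) //.
rewrite -mulmxA; set y := X *m x.
have n_ge0 := norm2_ge0; rewrite -(ler_pXn2r (n := 2)) ?nnegrE //; last first.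
  by rewrite mulr_ge0 // ltW.
rewrite exprMn !sqr_norm2_sum mulrC mulr_sumr ler_sum // => i _.
rewrite mul_diag_mx [X in _ <= X ^+ _]mxE exprMn ler_wpM2r ?sqr_ge0 //.
by rewrite ler_pXn2r // nnegrE ltW // (lt_le_trans c0).
Qed.

End SpectralNormTheory.

(** * Orthogonal changes of basis *)

Section OrthogonalMatrices.
Variable R : realType.

Lemma orthogonal_mxM (m : nat) (Q S : 'M[R]_m) :
  orthogonal_mx Q -> orthogonal_mx S -> orthogonal_mx (Q *m S).
Proof.
move=> [QtQ QQt] [StS SSt]; split; rewrite trmx_mul mulmxA.
  by rewrite -(mulmxA S^T) QtQ mulmx1.
by rewrite -(mulmxA Q) SSt mulmx1.
Qed.

Lemma tens_mx11 (m p : nat) : (1%:M : 'M[R]_m) *t (1%:M : 'M[R]_p) = 1%:M.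
Proof.
apply/matrixP => i j.
case: (mxtens_indexP i) => i1 i2; case: (mxtens_indexP j) => j1 j2.
rewrite tensmxE !mxE (can_eq (@mxtens_indexK _ _)) xpair_eqE.
by case: (i1 == j1); case: (i2 == j2); rewrite /= ?mulr1 ?mulr0.
Qed.

Lemma orthogonal_tens (m p : nat) (Q : 'M[R]_m) (S : 'M[R]_p) :
  orthogonal_mx Q -> orthogonal_mx S -> orthogonal_mx (Q *t S).
Proof.
move=> [QtQ QQt] [StS SSt]; split; rewrite trmx_tens tensmx_mul.
  by rewrite QtQ StS tens_mx11.
by rewrite QQt SSt tens_mx11.
Qed.

Lemma orthogonal_perm (m : nat) (P : 'M[R]_m) : is_perm_mx P -> orthogonal_mx P.
Proof.
case/is_perm_mxP => s ->; split; rewrite tr_perm_mx -perm_mxM.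
  by rewrite mulVg perm_mx1.
by rewrite mulgV perm_mx1.
Qed.

Lemma svd_diag (m : nat) (M U V : 'M[R]_m) (s : 'rV[R]_m) :
  is_svd M U s V -> U^T *m M *m V = diag_mx s.
Proof.
case=> [[UtU _] [VtV _] _ _ ->].
by rewrite !mulmxA UtU mul1mx -mulmxA VtV mulmx1.
Qed.

(** The matrix of [K] in the bases [U], [V] is kept as [U^T *m K *m V], so
    that the two factorizations of [K] are instances of the same equations. *)
Lemma change_basis_mulmx (m : nat) (K U V : 'M[R]_m) :
  orthogonal_mx U -> K *m V = U *m (U^T *m K *m V).
Proof. by case=> _ UUt; rewrite !mulmxA UUt mul1mx. Qed.

Lemma change_basis_trmulmx (m : nat) (K U V : 'M[R]_m) :
  orthogonal_mx V -> K^T *m U = V *m (U^T *m K *m V)^T.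
Proof. by case=> _ VVt; rewrite !trmx_mul trmxK !mulmxA VVt mul1mx. Qed.

Lemma perm_conj_is_diag (m : nat) (P D : 'M[R]_m) :
  is_perm_mx P -> is_diag_mx D -> is_diag_mx (P^T *m D *m P).
Proof.
case/is_perm_mxP => s -> /is_diag_mxP Dd; apply/is_diag_mxP => i j ij.
rewrite tr_perm_mx -row_permE -[s in perm_mx s]invgK -col_permE !mxE Dd //.
by apply: contra_neq ij => /val_inj/perm_inj ->.
Qed.

Lemma tens_diag (m p : nat) (d : 'rV[R]_m) (e : 'rV[R]_p) :
  is_diag_mx (diag_mx d *t diag_mx e).
Proof.
apply/is_diag_mxP => i j.
case: (mxtens_indexP i) => i1 i2; case: (mxtens_indexP j) => j1 j2 ij.
rewrite tensmxE !mxE; have [e1|_] := eqVneq i1 j1; last by rewrite mul0r.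
have [e2|_] := eqVneq i2 j2; last by rewrite mulr0.
by rewrite e1 e2 eqxx in ij.
Qed.

Lemma is_diag_mxE (m : nat) (D : 'M[R]_m) :
  is_diag_mx D -> D = diag_mx (\row_i D i i).
Proof.
by case/diag_mxP => d ->; congr diag_mx; apply/rowP => i; rewrite !mxE eqxx.
Qed.

End OrthogonalMatrices.

(** * Leading and trailing blocks *)

Section BlockTheory.
Variable R : realType.
Variables N k : nat.
Hypothesis le_kN : (k <= N)%N.

Lemma split_colsM (m p : nat) (A : 'M[R]_(m, p)) (B : 'M[R]_(p, N)) :
  split_cols le_kN (A *m B) = A *m split_cols le_kN B.
Proof. by rewrite /split_cols castmx_mul castmx_id. Qed.

Lemma split_colsM_blocks (m : nat) (A : 'M[R]_(m, N)) (G : 'M[R]_N) :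
  split_cols le_kN (A *m G) = split_cols le_kN A *m to_blocks le_kN G.
Proof.
rewrite /split_cols /to_blocks mulmx_cast castmx_comp /= castmx_id.
by rewrite castmx_mul castmx_id.
Qed.

Lemma to_blocksM (A B : 'M[R]_N) :
  to_blocks le_kN (A *m B) = to_blocks le_kN A *m to_blocks le_kN B.
Proof.
by rewrite /to_blocks; case: _ / (esym _); rewrite !castmx_id.
Qed.

Lemma to_blocks_tr (A : 'M[R]_N) : to_blocks le_kN A^T = (to_blocks le_kN A)^T.
Proof. by rewrite /to_blocks trmx_cast. Qed.

Lemma to_blocksD (A B : 'M[R]_N) :
  to_blocks le_kN (A + B) = to_blocks le_kN A + to_blocks le_kN B.
Proof. by apply/matrixP => i j; rewrite mxE !castmxE mxE. Qed.

Lemma of_blocksK : cancel (@of_blocks R N k le_kN) (to_blocks le_kN).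
Proof. by move=> A; apply: castmxK. Qed.

Lemma to_blocksK : cancel (to_blocks le_kN) (@of_blocks R N k le_kN).
Proof. by move=> A; apply: castmxKV. Qed.

Lemma to_blocks1 : to_blocks le_kN (1%:M : 'M[R]_N) = 1%:M.
Proof. by apply/matrixP => i j; rewrite castmxE !mxE. Qed.

Lemma to_blocks_diag (s : 'rV[R]_N) :
  to_blocks le_kN (diag_mx s) =
  block_mx (diag_mx (first_cols le_kN s)) 0 0 (diag_mx (last_cols le_kN s)).
Proof.
rewrite -diag_mx_row hsubmxK; apply/matrixP => i j.
by rewrite castmxE !mxE castmxE /= cast_ord_id.
Qed.

(** Reading an equation [K V = U G] one block column at a time. Applied to the
    exact decomposition this gives the invariance of the leading singular
    subspaces; applied to the approximate one, its residual. *)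
Lemma split_cols_mul_block (m p : nat) (K : 'M[R]_(m, p)) (V : 'M[R]_(p, N))
    (U : 'M[R]_(m, N)) (G : 'M[R]_N) ul ur dl dr :
  K *m V = U *m G -> to_blocks le_kN G = block_mx ul ur dl dr ->
  K *m first_cols le_kN V =
    first_cols le_kN U *m ul + last_cols le_kN U *m dl /\
  K *m last_cols le_kN V =
    first_cols le_kN U *m ur + last_cols le_kN U *m dr.
Proof.
move=> /(congr1 (fun A => split_cols le_kN A)); rewrite split_colsM_blocks.
rewrite split_colsM => KV GE; move: KV; rewrite GE -[split_cols le_kN V]hsubmxK -[split_cols le_kN U]hsubmxK.
by rewrite mul_mx_row mul_row_block => /eq_row_mx[].
Qed.

Lemma first_cols_isometry (Q : 'M[R]_N) : Q^T *m Q = 1%:M ->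
  (first_cols le_kN Q)^T *m first_cols le_kN Q = 1%:M.
Proof.
move=> QtQ; have : (split_cols le_kN Q)^T *m split_cols le_kN Q = 1%:M.
  rewrite -to_blocks1 -QtQ /split_cols trmx_cast /= /to_blocks castmx_mul.
  by rewrite mulmx_cast.
rewrite -[split_cols le_kN Q]hsubmxK tr_row_mx mul_col_row scalar_mx_block.
by case/eq_block_mx.
Qed.

Lemma orthogonal_blocks (Q : 'M[R]_k) : orthogonal_mx Q ->
  orthogonal_mx (of_blocks le_kN (block_mx Q 0 0 1%:M)).
Proof.
move=> [QtQ QQt]; split; apply: (can_inj to_blocksK);
  rewrite to_blocksM to_blocks_tr of_blocksK to_blocks1 tr_block_mx !trmx0 trmx1;
  by rewrite mulmx_block !mulmx0 !mul0mx !addr0 add0r mulmx1 ?QtQ ?QQt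
             -scalar_mx_block.
Qed.

End BlockTheory.

Lemma first_cols_ge_kth (R : realType) (N k : nat) (lt_kN : (k < N)%N)
    (s : 'rV[R]_N) (i : 'I_k) :
  (forall i j : 'I_N, (i <= j)%N -> s 0 j <= s 0 i) ->
  kth lt_kN s <= first_cols (ltnW lt_kN) s 0 i.
Proof.
move=> s_sorted; rewrite mxE castmxE cast_ord_id; apply: s_sorted => /=.
by have := ltn_ord i; case: k {lt_kN} i.
Qed.

(** * Perturbation of singular subspaces *)

Section SubspaceBound.
Variable R : realType.

(** Multiply the first inequality by [c], the second by [m], and add:
    [y] cancels. *)
Lemma coupled_bound (c m a b x y : R) : 0 <= m -> m < c ->
  c * x <= a + m * y -> c * y <= b + m * x ->
  x <= (c * a + b * m) / (c ^+ 2 - m ^+ 2).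
Proof.
move=> m0 mc hx hy; have c0 : 0 < c by exact: le_lt_trans mc.
have gap : 0 < c ^+ 2 - m ^+ 2 by rewrite subr_gt0 ltr_pXn2r // nnegrE ltW.
rewrite ler_pdivlMr //.
have := ler_wpM2l (ltW c0) hx; have := ler_wpM2l m0 hy; lra.
Qed.

Lemma specnorm_mul_contraction (m p q r : nat) (Q : 'M[R]_(q, m))
    (S : 'M[R]_(q, p)) (E : 'M[R]_(p, r)) :
  Q^T *m Q = 1%:M -> S^T *m S = 1%:M -> specnorm (Q^T *m S *m E) <= specnorm E.
Proof.
move=> /specnorm_isometry Q1 /specnorm_isometry S1.
rewrite -mulmxA (le_trans (specnormM _ _)) // specnorm_trmx.
rewrite (le_trans (ler_piMl (specnorm_ge0 _) Q1)) //.
rewrite (le_trans (specnormM _ _)) //.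
exact: ler_piMl (specnorm_ge0 _) S1.
Qed.

(** Columns [U], [V] spanning exact singular subspaces of [K] are compared with
    the complements [hU0], [hV0] of approximate ones, where [W12] and [W21]
    measure how far [hU], [hV] are from being invariant. Only the left bound is
    stated: the right one is this lemma for [K^T]. *)
Lemma singular_subspace_bound (m p k q l : nat) (K : 'M[R]_(m, p))
    (U : 'M[R]_(m, k)) (V : 'M[R]_(p, k)) (d : 'rV[R]_k)
    (hU : 'M[R]_(m, q)) (hV : 'M[R]_(p, q))
    (hU0 : 'M[R]_(m, l)) (hV0 : 'M[R]_(p, l))
    (W12 : 'M[R]_(q, l)) (W21 : 'M[R]_(l, q)) (M : 'M[R]_l) (c : R) :
  U^T *m U = 1%:M -> V^T *m V = 1%:M ->
  hU^T *m hU = 1%:M -> hV^T *m hV = 1%:M ->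
  K *m V = U *m diag_mx d -> K^T *m U = V *m diag_mx d ->
  K *m hV0 = hU *m W12 + hU0 *m M -> K^T *m hU0 = hV *m W21^T + hV0 *m M^T ->
  (forall i, c <= d 0 i) -> specnorm M < c ->
  specnorm (U^T *m hU0)
    <= (c * specnorm W21 + specnorm W12 * specnorm M)
       / (c ^+ 2 - specnorm M ^+ 2).
Proof.
move=> UU VV hUU hVV KV KtU KhV0 KthU0 cd Mc.
have M0 := specnorm_ge0 M; have c0 : 0 < c by exact: le_lt_trans Mc.
have dX : diag_mx d *m (U^T *m hU0) =
          V^T *m hV *m W21^T + V^T *m hV0 *m M^T.
  rewrite mulmxA -[diag_mx d]tr_diag_mx -trmx_mul -KV trmx_mul -[LHS]mulmxA KthU0.
  by rewrite mulmxDr !mulmxA.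
have dY : diag_mx d *m (V^T *m hV0) = U^T *m hU *m W12 + U^T *m hU0 *m M.
  rewrite mulmxA -[diag_mx d]tr_diag_mx -trmx_mul -KtU trmx_mul trmxK -[LHS]mulmxA.
  by rewrite KhV0 mulmxDr !mulmxA.
apply: (coupled_bound (y := specnorm (V^T *m hV0))) => //.
  rewrite (le_trans (specnorm_diag_mull _ c0 cd)) // dX.
  rewrite (le_trans (specnormD _ _)) // lerD //.
    by rewrite -(specnorm_trmx W21) specnorm_mul_contraction.
  by rewrite mulrC -(specnorm_trmx M) specnormM.
rewrite (le_trans (specnorm_diag_mull _ c0 cd)) // dY.
rewrite (le_trans (specnormD _ _)) // lerD ?specnorm_mul_contraction //.
by rewrite mulrC specnormM.
Qed.

End SubspaceBound.

(** * The Kronecker approximation *)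

Theorem theorem3p1 (R : realType) (n k : nat)
    (k_gt0 : (0 < k)%N) (lt_kN : (k < n * n)%N)
    (K : 'M[R]_(n * n))
    (* the true singular value decomposition *)
    (U V : 'M[R]_(n * n)) (sigma : 'rV[R]_(n * n))
    (K_svd : is_svd K U sigma V)
    (* the Kronecker sum decomposition, of Kronecker rank r.+1 *)
    (r : nat) (s : 'I_r.+1 -> R) (u v : 'I_r.+1 -> 'cV[R]_(n * n))
    (A B : 'I_r.+1 -> 'M[R]_n)
    (K_kron : is_kron_svd K s u v A B)
    (* SVDs of the factors of the dominant term *)
    (UA VA : 'M[R]_n) (sA : 'rV[R]_n) (A1_svd : is_svd (A ord0) UA sA VA)
    (UB VB : 'M[R]_n) (sB : 'rV[R]_n) (B1_svd : is_svd (B ord0) UB sB VB)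
    (U1 := UA *t UB)
    (Sigma1 := diag_mx sA *t diag_mx sB)
    (V1 := VA *t VB)
    (W := U1^T *m (\sum_(i | i != ord0) A i *t B i) *m V1)
    (* the sorting permutation *)
    (P : 'M[R]_(n * n)) (P_perm : is_perm_mx P)
    (sigma1 := \row_i (P^T *m Sigma1 *m P) i i)
    (sigma1_sorted : forall i j : 'I_(n * n),
       (i <= j)%N -> sigma1 0 j <= sigma1 0 i)
    (le_kN := ltnW lt_kN)
    (Sigma1k := diag_mx (first_cols le_kN sigma1))
    (hSigma0 := diag_mx (last_cols le_kN sigma1))
    (W11 := ulsubmx (to_blocks le_kN (P^T *m W *m P)))
    (W12 := ursubmx (to_blocks le_kN (P^T *m W *m P)))
    (W21 := dlsubmx (to_blocks le_kN (P^T *m W *m P)))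
    (W22 := drsubmx (to_blocks le_kN (P^T *m W *m P)))
    (* SVD of the leading block; hsigma are the approximate singular values *)
    (hUt hVt : 'M[R]_k) (hsigma : 'rV[R]_k)
    (t_svd : is_svd (Sigma1k + W11) hUt hsigma hVt)
    (hW12 := hUt^T *m W12)
    (hW21 := W21 *m hVt)
    (hU := U1 *m P *m of_blocks le_kN (block_mx hUt 0 0 1%:M))
    (hV := V1 *m P *m of_blocks le_kN (block_mx hVt 0 0 1%:M))
    (sigmak := kth lt_kN sigma)
    (* the denominators below are positive *)
    (gap : specnorm (hSigma0 + W22) < sigmak) :
  specnorm ((first_cols le_kN U)^T *m last_cols le_kN hU)
    <= (sigmak * specnorm hW21 + specnorm hW12 * specnorm (hSigma0 + W22))
       / (sigmak ^+ 2 - specnorm (hSigma0 + W22) ^+ 2)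
  /\
  specnorm ((first_cols le_kN V)^T *m last_cols le_kN hV)
    <= (sigmak * specnorm hW12 + specnorm hW21 * specnorm (hSigma0 + W22))
       / (sigmak ^+ 2 - specnorm (hSigma0 + W22) ^+ 2).

Proof.
have [U_orth V_orth _ sigma_sorted _] := K_svd.
have [UA_orth VA_orth _ _ _] := A1_svd; have [UB_orth VB_orth _ _ _] := B1_svd.
have [hUt_orth hVt_orth _ _ _] := t_svd.
have P_orth := orthogonal_perm P_perm.
have hU_orth : orthogonal_mx hU.
  apply: orthogonal_mxM (orthogonal_blocks le_kN hUt_orth).
  exact: orthogonal_mxM (orthogonal_tens UA_orth UB_orth) P_orth.
have hV_orth : orthogonal_mx hV.
  apply: orthogonal_mxM (orthogonal_blocks le_kN hVt_orth).
  exact: orthogonal_mxM (orthogonal_tens VA_orth VB_orth) P_orth.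
have core : U1^T *m K *m V1 = Sigma1 + W.
  rewrite (kron_svd_sum K_kron) (bigD1 ord0) //= mulmxDr mulmxDl; congr (_ + _).
  by rewrite trmx_tens !tensmx_mul (svd_diag A1_svd) (svd_diag B1_svd).
have sorted_core : to_blocks le_kN (P^T *m (Sigma1 + W) *m P) =
    block_mx (Sigma1k + W11) W12 W21 (hSigma0 + W22).
  rewrite mulmxDr mulmxDl to_blocksD.
  rewrite (is_diag_mxE (perm_conj_is_diag P_perm (tens_diag sA sB))).
  rewrite to_blocks_diag -[to_blocks _ (P^T *m W *m P)]submxK add_block_mx.
  by rewrite !add0r.
have GE : to_blocks le_kN (hU^T *m K *m hV) =
    block_mx (hUt^T *m (Sigma1k + W11) *m hVt) hW12 hW21 (hSigma0 + W22).
  have -> : hU^T *m K *m hV =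
      (of_blocks le_kN (block_mx hUt 0 0 1%:M))^T
        *m (P^T *m (Sigma1 + W) *m P)
        *m of_blocks le_kN (block_mx hVt 0 0 1%:M).
    by rewrite -core /hU /hV !trmx_mul !mulmxA.
  rewrite 2!to_blocksM sorted_core to_blocks_tr !of_blocksK tr_block_mx.
  rewrite !trmx0 trmx1 !mulmx_block.
  by rewrite !(mulmx0, mul0mx, addr0, add0r, mul1mx, mulmx1).
have GtE := congr1 trmx GE; rewrite -to_blocks_tr tr_block_mx in GtE.
have [_ KhV0] := split_cols_mul_block (change_basis_mulmx K hV hU_orth) GE.
have [_ KthU0] := split_cols_mul_block (change_basis_trmulmx K hU hV_orth) GtE.
have KV := change_basis_mulmx K V U_orth.
have KtU := change_basis_trmulmx K U V_orth.
rewrite (svd_diag K_svd) in KV; rewrite (svd_diag K_svd) tr_diag_mx in KtU.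
have [+ _] := split_cols_mul_block KV (to_blocks_diag le_kN sigma).
rewrite mulmx0 addr0 => KVk.
have [+ _] := split_cols_mul_block KtU (to_blocks_diag le_kN sigma).
rewrite mulmx0 addr0 => KtUk.
have le_sigma i := first_cols_ge_kth lt_kN i sigma_sorted.
have isom (Q : 'M[R]_(n * n)) (Q_orth : orthogonal_mx Q) := first_cols_isometry le_kN Q_orth.1.
split.
  exact: (singular_subspace_bound (isom _ U_orth) (isom _ V_orth)
    (isom _ hU_orth) (isom _ hV_orth) KVk KtUk KhV0 KthU0 le_sigma gap).
(* For the right bound [K^T] plays the role of [K], so [K], [hW12] and the
   trailing block must be displayed as transposes. *)
rewrite -[K]trmxK in KhV0 KVk.
rewrite -[hW12]trmxK -[hSigma0 + W22]trmxK in KhV0.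
rewrite -(specnorm_trmx hW12) -(specnorm_trmx hW21).
rewrite -(specnorm_trmx (hSigma0 + W22)) in gap *.
exact: (singular_subspace_bound (isom _ V_orth) (isom _ U_orth)
  (isom _ hV_orth) (isom _ hU_orth) KtUk KVk KthU0 KhV0 le_sigma gap).
Qed.
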